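(* Let $A\in\mathbb{R}^{n\times n}$ be arbitrary. Then for almost every $T>0$ (that is, for all $T>0$ outside a set of Lebesgue measure zero), the finite-time controllability scoring problem (FTCSP) $$\text{minimize } h_T(p) \quad \text{subject to } p\in X_T\cap\Delta$$ admits a unique optimal solution, both in the case $h_T=f_T$ (the solution being called the VCS) and in the case $h_T=g_T$ (the solution being called the AECS).
   Context: For $T>0$ and $i=1,\dots,n$ let $e_i$ be the $i$-th standard basis vector of $\mathbb{R}^n$ and $W_i(T):=\int_0^T e^{At}e_ie_i^\top e^{A^\top t}\,dt$. For $p=(p_i)\in\mathbb{R}^n$ put $W(p,T):=\sum_{i=1}^n p_iW_i(T)$. Define $X_T:=\{p\in\mathbb{R}^n : W(p,T)\succ 0\}$ (positive definite) and the standard simplex $\Delta:=\{p\in\mathbb{R}^n:\sum_i p_i=1,\ p_i\ge 0\ \forall i\}$. On $X_T$ define $f_T(p):=-\log\det W(p,T)$ and $g_T(p):=\operatorname{tr}(W(p,T)^{-1})$. *)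

(* Defs.v *)
From HB Require Import structures.
From mathcomp Require Import all_boot all_order all_algebra.
From mathcomp Require Import all_classical all_reals all_analysis.
Set Implicit Arguments. Unset Strict Implicit. Unset Printing Implicit Defensive.
Import Order.TTheory GRing.Theory Num.Theory.
Import numFieldNormedType.Exports.
Local Open Scope classical_set_scope.
Local Open Scope ring_scope.

Section FTCSP.
Variables (R : realType) (n : nat).

Definition expmx (A : 'M[R]_n) (t : R) : 'M[R]_n :=
  \matrix_(i, j) lim ((fun N : nat =>
       (\sum_(k < N) ((t ^+ k / (k`!)%:R) *: (A ^+ k))) i j) @ \oo).

Definition Wi (A : 'M[R]_n) (i : 'I_n) (T : R) : 'M[R]_n :=
  \matrix_(j, k) Rintegral (@lebesgue_measure R) `[0, T]
     (fun t => (expmx A t *m delta_mx i i *m expmx A^T t) j k).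

Definition Wp (A : 'M[R]_n) (p : 'cV[R]_n) (T : R) : 'M[R]_n :=
  \sum_(i < n) p i 0 *: Wi A i T.

Definition posdef (M : 'M[R]_n) : Prop :=
  M^T = M /\ forall x : 'cV[R]_n, x != 0 -> 0 < (x^T *m M *m x) 0 0.

Definition XT (A : 'M[R]_n) (T : R) : set 'cV[R]_n :=
  [set p | posdef (Wp A p T)].

Definition simplex : set 'cV[R]_n :=
  [set p | \sum_(i < n) p i 0 = 1 /\ forall i, 0 <= p i 0].

Definition fT (A : 'M[R]_n) (T : R) (p : 'cV[R]_n) : R :=
  - ln (\det (Wp A p T)).

Definition gT (A : 'M[R]_n) (T : R) (p : 'cV[R]_n) : R :=
  \tr (invmx (Wp A p T)).

Definition unique_minimizer (h : 'cV[R]_n -> R) (F : set 'cV[R]_n) : Prop :=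
  exists! p, F p /\ forall q, F q -> h p <= h q.

End FTCSP.

(* Main.v *)
(** Strict convexity of - ln det and of tr (W^-1) on positive definite matrices gives
    uniqueness as soon as the W_i(T) are linearly independent. For that it suffices that
    the matrix D(T) of their diagonals, D(T)_ij = (W_i(T))_jj, is invertible. The
    derivatives of det D grow at most geometrically, so det D has countably many zeros
    unless it vanishes identically, and D(t) / t tends to the identity at 0.
    Strict convexity avoids spectral theory: ln det M < tr M - n for positive definite
    M <> 1, by induction on Schur complements, and tr (W^-1) is the maximum over X of
    2 tr X - tr (X^T W X), attained only at X = W^-1. *)

Require Import Defs.
From HB Require Import structures.
From mathcomp Require Import all_boot all_order all_algebra.
From mathcomp Require Import all_classical all_reals all_analysis.
From mathcomp Require Import ring lra.
Import Order.TTheory GRing.Theory Num.Theory.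
Import numFieldNormedType.Exports.
Local Open Scope classical_set_scope.
Local Open Scope ring_scope.
Set Implicit Arguments. Unset Strict Implicit. Unset Printing Implicit Defensive.

Section PositiveDefinite.
Variable R : realType.

Local Notation qf M x := ((x^T *m M *m x) 0 0).

Lemma addmxE m n (A B : 'M[R]_(m, n)) i j : (A + B) i j = A i j + B i j.
Proof. by rewrite mxE. Qed.

Lemma scalemxE m n (c : R) (A : 'M[R]_(m, n)) i j : (c *: A) i j = c * A i j.
Proof. by rewrite mxE. Qed.

Lemma mul_trmx_sym n (x y : 'cV[R]_n) : (x^T *m y) 0 0 = (y^T *m x) 0 0.
Proof. by rewrite !mxE; apply: eq_bigr => i _; rewrite !mxE mulrC. Qed.

Lemma qf_scale n (M : 'M[R]_n) (c : R) (x : 'cV[R]_n) : qf (c *: M) x = c * qf M x.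
Proof. by rewrite -scalemxAr -scalemxAl mxE. Qed.

Lemma qf_add n (M N : 'M[R]_n) (x : 'cV[R]_n) : qf (M + N) x = qf M x + qf N x.
Proof. by rewrite mulmxDr mulmxDl mxE. Qed.

Lemma qf_sum n (I : finType) (M : I -> 'M[R]_n) (x : 'cV[R]_n) :
  qf (\sum_i M i) x = \sum_i qf (M i) x.
Proof. by rewrite mulmx_sumr mulmx_suml summxE. Qed.

Lemma cV_sqr_ge0 n (x : 'cV[R]_n) : 0 <= (x^T *m x) 0 0.
Proof. by rewrite mxE sumr_ge0// => i _; rewrite mxE -expr2 sqr_ge0. Qed.

Lemma cV_sqr_eq0 n (x : 'cV[R]_n) : (x^T *m x) 0 0 = 0 -> x = 0.
Proof.
rewrite mxE => /eqP; rewrite psumr_eq0 => [/allP h|i _]; last first.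
  by rewrite mxE -expr2 sqr_ge0.
apply/colP => i; rewrite mxE.
by have := h i (mem_index_enum _); rewrite mxE -expr2 sqrf_eq0 => /eqP.
Qed.

Lemma posdef1 n : posdef (1%:M : 'M[R]_n).
Proof.
split=> [|x x0]; first by rewrite trmx1.
rewrite mulmx1 lt_def cV_sqr_ge0 andbT.
by apply: contra x0 => /eqP /cV_sqr_eq0 ->.
Qed.

Lemma posdef_ge0 n (M : 'M[R]_n) (x : 'cV[R]_n) : posdef M -> 0 <= qf M x.
Proof.
move=> [_ pM]; have [->|/pM/ltW//] := eqVneq x 0.
by rewrite mulmx0 mxE.
Qed.

Lemma posdef_unit n (M : 'M[R]_n) : posdef M -> M \in unitmx.
Proof.
move=> [sM pM]; rewrite -row_free_unit -kermx_eq0; apply/negPn/negP.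
case/rowV0Pn => v /sub_kermxP vM v0.
have /pM : v^T != 0 by rewrite -trmx0 (inj_eq trmx_inj).
by rewrite trmxK vM mul0mx mxE ltxx.
Qed.

Lemma posdef_congr n (M P : 'M[R]_n) : P \in unitmx -> posdef M ->
  posdef (P^T *m M *m P).
Proof.
move=> uP [sM pM]; split=> [|x x0].
  by rewrite !trmx_mul trmxK sM mulmxA.
have -> : x^T *m (P^T *m M *m P) *m x = (P *m x)^T *m M *m (P *m x).
  by rewrite trmx_mul !mulmxA.
apply: pM; apply: contra x0 => /eqP Px.
by rewrite -(mulKmx uP x) Px mulmx0.
Qed.

Lemma posdef_inv n (M : 'M[R]_n) : posdef M -> posdef (invmx M).
Proof.
move=> pM; have uM := posdef_unit pM.
have -> : invmx M = (invmx M)^T *m M *m invmx M.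
  by rewrite trmx_inv pM.1 mulVmx// mul1mx.
by apply: posdef_congr => //; rewrite unitmx_inv.
Qed.

Lemma posdef_add n (M N : 'M[R]_n) : posdef M -> posdef N -> posdef (M + N).
Proof.
move=> [sM pM] [sN pN]; split=> [|x x0]; first by rewrite linearD/= sM sN.
by rewrite qf_add addr_gt0 ?pM ?pN.
Qed.

Lemma posdef_scale n (c : R) (M : 'M[R]_n) : 0 < c -> posdef M -> posdef (c *: M).
Proof.
move=> c0 [sM pM]; split=> [|x x0]; first by rewrite linearZ/= sM.
by rewrite qf_scale mulr_gt0 ?pM.
Qed.

Lemma quad_ge0_lin0 (b c : R) : 0 <= c ->
  (forall s, 0 <= 2 * s * b + s ^+ 2 * c) -> b = 0.
Proof.
move=> c0 /(_ (- b / (c + 1))); have c1 : c + 1 != 0 by lra.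
have -> : 2 * (- b / (c + 1)) * b + (- b / (c + 1)) ^+ 2 * c =
   - (b ^+ 2 * (c + 2) / (c + 1) ^+ 2) by field.
rewrite oppr_ge0 pmulr_lle0 ?invr_gt0 ?exprn_gt0//; last by lra.
rewrite pmulr_lle0; last by lra.
by move=> b2; apply/eqP; rewrite -sqrf_eq0 eq_le b2 sqr_ge0.
Qed.

Lemma semidef_kernel n (M : 'M[R]_n) (x : 'cV[R]_n) : M^T = M ->
  (forall y : 'cV[R]_n, 0 <= qf M y) -> qf M x = 0 -> M *m x = 0.
Proof.
move=> sM pM qx; set y := M *m x; apply: cV_sqr_eq0.
set b := (X in X = 0); set c := qf M y.
have xMy : (x^T *m M *m y) 0 0 = b by rewrite /b /y trmx_mul sM.
have yMx : (y^T *m M *m x) 0 0 = b by rewrite -mulmxA.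
have h s : 0 <= 2 * s * b + s ^+ 2 * c.
  have := pM (x + s *: y).
  rewrite [(x + _)^T]linearD/= [(s *: y)^T]linearZ/= !mulmxDl !mulmxDr.
  rewrite -!scalemxAr -!scalemxAl !addmxE !scalemxE qx.
  rewrite -/c xMy yMx; set u := _ + _; suff -> : u = 2 * s * b + s ^+ 2 * c by [].
  by rewrite /u; ring.
exact: (quad_ge0_lin0 (pM y) h).
Qed.

Lemma semidef_unit_posdef n (M : 'M[R]_n) : M^T = M ->
  (forall y : 'cV[R]_n, 0 <= qf M y) -> M \in unitmx -> posdef M.
Proof.
move=> sM pM uM; split=> // x x0; rewrite lt_def pM andbT.
apply: contra x0 => /eqP /(semidef_kernel sM pM) Mx.
by rewrite -(mulKmx uM x) Mx mulmx0.
Qed.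

Lemma posdef_blockP n (M : 'M[R]_(1 + n)) : posdef M ->
  exists a : R, exists u : 'cV[R]_n, exists S : 'M[R]_n,
    [/\ M = block_mx a%:M u^T u (S + a^-1 *: (u *m u^T)), 0 < a & posdef S].
Proof.
move=> [sM pM]; set a := M 0 0; set u := dlsubmx M; set B := drsubmx M.
have ulM : ulsubmx M = a%:M.
  by rewrite [LHS]mx11_scalar !mxE; congr (M _ _)%:M; apply: val_inj.
have urM : ursubmx M = u^T by rewrite /u trmx_dlsub sM.
have sB : B^T = B by rewrite /B trmx_drsub sM.
have ME : M = block_mx a%:M u^T u B by rewrite -[LHS]submxK ulM urM.
have q (s : R) (y : 'cV[R]_n) : qf M (col_mx s%:M y) =
    s ^+ 2 * a + 2 * s * (u^T *m y) 0 0 + qf B y.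
  rewrite ME tr_col_mx tr_scalar_mx mul_row_block mul_row_col.
  rewrite !mul_scalar_mx mul_mx_scalar mulmxDl -scalemxAl !addmxE !scalemxE.
  rewrite !addmxE !scalemxE (mul_trmx_sym y) mxE eqxx mulr1n; ring.
have a0 : 0 < a.
  have <- : qf M (col_mx 1%:M 0) = a.
    by rewrite q !mulmx0 !mxE expr1n mul1r mulr0 !addr0.
  apply: pM; rewrite col_mx_eq0 negb_and; apply/orP; left.
  by apply/eqP => /matrixP/(_ 0 0)/eqP; rewrite !mxE/= oner_eq0.
exists a, u, (B - a^-1 *: (u *m u^T)); split=> //; first by rewrite subrK.
split=> [|y y0].
  by rewrite linearB/= linearZ/= trmx_mul trmxK sB.
have := pM (col_mx (- a^-1 * (u^T *m y) 0 0)%:M y); rewrite q.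
rewrite col_mx_eq0 negb_and y0 orbT => /(_ isT).
rewrite qf_add -scaleNr qf_scale.
have -> : qf (u *m u^T) y = (u^T *m y) 0 0 ^+ 2.
  rewrite mulmxA -mulmxA [X in (X *m _) 0 0]mx11_scalar mul_scalar_mx mxE.
  by rewrite mul_trmx_sym.
have -> : (- a^-1 * (u^T *m y) 0 0) ^+ 2 * a +
   2 * (- a^-1 * (u^T *m y) 0 0) * (u^T *m y) 0 0 + qf B y =
   qf B y + - a^-1 * (u^T *m y) 0 0 ^+ 2; last by [].
by field; rewrite gt_eqF.
Qed.

Lemma det_schur n (a : R) (u : 'cV[R]_n) (S : 'M[R]_n) : a != 0 ->
  \det (block_mx a%:M u^T u (S + a^-1 *: (u *m u^T))) = a * \det S.
Proof.
move=> a0.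
have -> : block_mx a%:M u^T u (S + a^-1 *: (u *m u^T)) =
    block_mx 1%:M 0 (a^-1 *: u) 1%:M *m block_mx a%:M u^T 0 S.
  rewrite mulmx_block !mul0mx !mul1mx !addr0 mul_mx_scalar.
  by rewrite scalerA mulfV// scale1r -scalemxAl addrC.
by rewrite det_mulmx det_lblock det_ublock !det1 !mul1r det_scalar1.
Qed.

Lemma posdef_det_gt0 n (M : 'M[R]_n) : posdef M -> 0 < \det M.
Proof.
elim: n M => [|n IH] M pM; first by rewrite det_mx00.
have [a [u [S [-> a0 pS]]]] := @posdef_blockP n M pM.
by rewrite det_schur ?gt_eqF// mulr_gt0// IH.
Qed.

Lemma cholesky n (M : 'M[R]_n) : posdef M -> exists L : 'M[R]_n, M = L *m L^T.
Proof.
elim: n M => [|n IH] M pM; first by exists 0; rewrite [LHS]flatmx0 [RHS]flatmx0.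
have [a [u [S [-> a0 /IH[L ->]]]]] := @posdef_blockP n M pM.
have ra0 : Num.sqrt a != 0 by rewrite sqrtr_eq0 -ltNge.
exists (block_mx (Num.sqrt a)%:M 0 ((Num.sqrt a)^-1 *: u) L).
rewrite (@tr_block_mx _ 1 n 1 n) (@mulmx_block _ 1 n 1 n 1 n) tr_scalar_mx !trmx0.
rewrite !mul0mx !mulmx0 !addr0 -scalar_mxM -expr2 sqr_sqrtr ?ltW//.
rewrite mul_scalar_mx mul_mx_scalar linearZ/= !scalerA mulfV// !scale1r.
rewrite -scalemxAl -scalemxAr scalerA -invfM -expr2 sqr_sqrtr ?ltW//.
by rewrite [in RHS]addrC.
Qed.

Lemma ln_ltB1 (a : R) : 0 < a -> a != 1 -> ln a < a - 1.
Proof.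
move=> a0 a1; rewrite -ltr_expR lnK ?posrE//.
rewrite -[X in X < _](addrNK 1) addrC.
by rewrite expR_gt1Dx// subr_eq0.
Qed.

Lemma ln_leB1 (a : R) : 0 < a -> ln a <= a - 1.
Proof.
move=> a0; have [->|/(ln_ltB1 a0)/ltW//] := eqVneq a 1.
by rewrite ln1 subrr.
Qed.

(* With [M = block a u^T u _] and Schur complement [S]: det M = a det S, and
   tr M = a + tr S + |u|^2 / a. *)
Lemma ln_det_lt_trace n (M : 'M[R]_n) : posdef M -> M != 1%:M ->
  ln (\det M) < \tr M - n%:R.
Proof.
elim: n M => [|n IH] M pM; first by rewrite [M]flatmx0 [1%:M]flatmx0 eqxx.
have [a [u [S [-> a0 pS]]]] := @posdef_blockP n M pM.
rewrite (scalar_mx_block 1 n) => M1.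
rewrite det_schur ?gt_eqF// lnM ?posrE ?posdef_det_gt0//.
rewrite (@mxtrace_block _ 1 n) mxtrace_scalar mulr1n linearD/= linearZ/=.
rewrite mxtrace_mulC trace_mx11 -natr1.
have u0 := cV_sqr_ge0 u; have la := ln_leB1 a0.
have au0 : 0 <= a^-1 * (u^T *m u) 0 0 by rewrite mulr_ge0// invr_ge0 ltW.
have lS : ln (\det S) <= \tr S - n%:R.
  have [->|/(IH _ pS)/ltW//] := eqVneq S 1%:M.
  by rewrite det1 ln1 mxtrace_scalar subrr.
have [SE|/(IH _ pS) ?] := eqVneq S 1%:M; last by lra.
have [aE|/(ln_ltB1 a0) ?] := eqVneq a 1; last by lra.
suff : 0 < a^-1 * (u^T *m u) 0 0 by lra.
rewrite mulr_gt0 ?invr_gt0// lt_def u0 andbT.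
apply: contra M1 => /eqP /cV_sqr_eq0 ->.
by rewrite SE aE mul0mx scaler0 addr0 trmx0.
Qed.

Lemma ln_det_le_trace n (M : 'M[R]_n) : posdef M -> ln (\det M) <= \tr M - n%:R.
Proof.
move=> pM; have [->|/(ln_det_lt_trace pM)/ltW//] := eqVneq M 1%:M.
by rewrite det1 ln1 mxtrace_scalar subrr.
Qed.

Lemma ln_det_mid_concave n (M N : 'M[R]_n) : posdef M -> posdef N -> M != N ->
  ln (\det M) + ln (\det N) < 2 * ln (\det (2^-1 *: (M + N))).
Proof.
move=> pM pN MN; set K := 2^-1 *: (M + N).
have pK : posdef K by apply: posdef_scale; rewrite ?invr_gt0//; exact: posdef_add.
have uK := posdef_unit pK.
have [L LE] := cholesky (posdef_inv pK).
have uL : L \in unitmx.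
  by have := unitmx_inv K; rewrite uK LE unitmx_mul => /andP[].
have uLT : L^T \in unitmx by rewrite unitmx_tr.
have pc (X : 'M[R]_n) : posdef X -> [/\ posdef (L^T *m X *m L),
    ln (\det (L^T *m X *m L)) = ln (\det X) - ln (\det K) &
    \tr (L^T *m X *m L) = \tr (X *m invmx K)].
  move=> pX; split; first exact: posdef_congr.
    rewrite !det_mulmx mulrAC -det_mulmx det_mulmx mulrC [\det L^T * _]mulrC.
    rewrite -det_mulmx -LE det_inv lnM ?posrE ?invr_gt0 ?posdef_det_gt0//.
    by rewrite lnV// posrE posdef_det_gt0.
  by rewrite -mulmxA mxtrace_mulC -mulmxA -LE.
have [pM' dM tM] := pc M pM; have [pN' dN tN] := pc N pN.
have tMN : \tr (M *m invmx K) + \tr (N *m invmx K) = 2 * n%:R.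
  rewrite -linearD/= -mulmxDl.
  have -> : M + N = 2 *: K by rewrite /K scalerA mulfV// scale1r.
  by rewrite -scalemxAl mulmxV// linearZ/= mxtrace_scalar.
have hM := ln_det_le_trace pM'; have hN := ln_det_le_trace pN'.
rewrite dM tM in hM; rewrite dN tN in hN.
have [ME|/(ln_det_lt_trace pM')] := eqVneq (L^T *m M *m L) 1%:M; last first.
  by rewrite dM tM; lra.
have [NE|/(ln_det_lt_trace pN')] := eqVneq (L^T *m N *m L) 1%:M; last first.
  by rewrite dN tN; lra.
case/eqP: MN; apply: (can_inj (mulKmx uLT)); apply: (can_inj (mulmxK uL)).
by rewrite ME NE.
Qed.

(* tr W^-1 is the maximum over X of this affine function of W, attained at W^-1 only. *)
Definition invtr_minorant n (X W : 'M[R]_n) : R := 2 * \tr X - \tr (X^T *m W *m X).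

Lemma trace_congr n (X W : 'M[R]_n) :
  \tr (X^T *m W *m X) = \sum_i qf W (col i X).
Proof.
apply: eq_bigr => i _; rewrite !mxE; apply: eq_bigr => j _.
rewrite !mxE; congr (_ * _).
by apply: eq_bigr => k _; rewrite !mxE.
Qed.

Lemma invtr_minorantE n (X W : 'M[R]_n) : posdef W ->
  invtr_minorant X W = \tr (invmx W)
     - \tr ((X - invmx W)^T *m W *m (X - invmx W)).
Proof.
move=> pW; have uW := posdef_unit pW; rewrite /invtr_minorant.
rewrite [(X - _)^T]linearB/= trmx_inv pW.1 mulmxBl mulVmx// mulmxBr !mulmxBl mul1mx.
rewrite mulmxK// mul1mx !linearB/= mxtrace_tr; ring.
Qed.

Lemma invtr_minorant_le n (X W : 'M[R]_n) : posdef W ->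
  invtr_minorant X W <= \tr (invmx W).
Proof.
move=> pW; rewrite invtr_minorantE// gerBl trace_congr sumr_ge0// => i _.
exact: posdef_ge0.
Qed.

Lemma invtr_minorant_lt n (X W : 'M[R]_n) : posdef W -> X != invmx W ->
  invtr_minorant X W < \tr (invmx W).
Proof.
move=> pW XW; rewrite lt_def invtr_minorant_le// andbT.
apply: contra XW => /eqP; rewrite invtr_minorantE// => h.
have /eqP : \tr ((X - invmx W)^T *m W *m (X - invmx W)) = 0 by lra.
rewrite trace_congr psumr_eq0 => [/allP q0|i _]; last exact: posdef_ge0.
rewrite -subr_eq0; apply/eqP/matrixP => j i.
have /eqP qi := q0 i (mem_index_enum _).
have [c0|/(pW.2)] := eqVneq (col i (X - invmx W)) 0; last by rewrite qi ltxx.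
by move/colP : c0 => /(_ j); rewrite !mxE.
Qed.

Lemma invtr_minorant_inv n (W : 'M[R]_n) : posdef W ->
  invtr_minorant (invmx W) W = \tr (invmx W).
Proof. by move=> pW; rewrite invtr_minorantE// subrr mulmx0 mxtrace0 subr0. Qed.

Lemma invtr_mid_convex n (M N : 'M[R]_n) : posdef M -> posdef N -> M != N ->
  2 * \tr (invmx (2^-1 *: (M + N))) < \tr (invmx M) + \tr (invmx N).
Proof.
move=> pM pN MN; set K := 2^-1 *: (M + N).
have pK : posdef K by apply: posdef_scale; rewrite ?invr_gt0//; exact: posdef_add.
rewrite -(invtr_minorant_inv pK); set X := invmx K.
have -> : 2 * invtr_minorant X K = invtr_minorant X M + invtr_minorant X N.
  rewrite /invtr_minorant /K -scalemxAr -scalemxAl linearZ/= mulmxDr mulmxDl.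
  by rewrite linearD/=; field.
have hM := invtr_minorant_le X pM; have hN := invtr_minorant_le X pN.
have [XM|/(invtr_minorant_lt pM)] := eqVneq X (invmx M); last by lra.
have [XN|/(invtr_minorant_lt pN)] := eqVneq X (invmx N); last by lra.
by case/eqP: MN; apply: (can_inj (@invmxK _ _)); rewrite -XM -XN.
Qed.

Lemma invtr_bounded_posdef n (W : 'M[R]_n) (c : R) : W^T = W ->
  (forall y : 'cV[R]_n, 0 <= qf W y) ->
  (forall X, invtr_minorant X W <= c) -> posdef W.
Proof.
move=> sW pW hc; split=> // x x0; rewrite lt_def pW andbT; apply/negP => /eqP qx.
have Wx := semidef_kernel sW pW qx.
set r := (x^T *m x) 0 0.
have r0 : 0 < r.
  rewrite lt_def cV_sqr_ge0 andbT; apply: contra x0 => /eqP /cV_sqr_eq0 ->//.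
have := hc (((`|c| + 1) / r) *: (x *m x^T)).
rewrite /invtr_minorant -scalemxAr -mulmxA mulmxA.
rewrite -(mulmxA _ W) (mulmxA W) Wx mul0mx mulmx0 scaler0 mxtrace0 subr0.
rewrite linearZ/= mxtrace_mulC trace_mx11 -/r divfK ?gt_eqF//.
by have := ler_norm c; have := normr_ge0 c; lra.
Qed.

End PositiveDefinite.

Section Optimization.
Variable R : realType.

Lemma cvg_det (T : Type) (F : set_system T) (FF : Filter F) m
    (f : T -> 'M[R]_m) (l : 'M[R]_m) :
  (forall i j, f x i j @[x --> F] --> l i j) ->
  \det (f x) @[x --> F] --> \det l.
Proof.
move=> fl; rewrite /determinant; apply: cvg_big => [|s _]; first exact: add_continuous.
apply: cvgM; first exact: cvg_cst.
by apply: cvg_big => [|i _]; [exact: mul_continuous|exact: fl].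
Qed.

Lemma cvg_trace_adj (T : Type) (F : set_system T) (FF : Filter F) m
    (f : T -> 'M[R]_m) (l : 'M[R]_m) :
  (forall i j, f x i j @[x --> F] --> l i j) ->
  \tr (\adj (f x)) @[x --> F] --> \tr (\adj l).
Proof.
move=> fl; rewrite /mxtrace; apply: cvg_big => [|s _]; first exact: add_continuous.
rewrite mxE; under eq_fun do rewrite mxE.
apply: cvgM; first exact: cvg_cst.
apply: cvg_det => i j; rewrite !mxE; under eq_fun do rewrite !mxE.
exact: fl.
Qed.

Lemma continuous_det (T : topologicalType) m (f : T -> 'M[R]_m) :
  (forall i j, continuous (fun x => f x i j)) -> continuous (fun x => \det (f x)).
Proof. by move=> cf x; apply: cvg_det => i j; exact: cf. Qed.

Lemma continuous_trace_adj (T : topologicalType) m (f : T -> 'M[R]_m) :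
  (forall i j, continuous (fun x => f x i j)) -> continuous (fun x => \tr (\adj (f x))).
Proof. by move=> cf x; apply: cvg_trace_adj => i j; exact: cf. Qed.

Lemma trace_invE m (M : 'M[R]_m) : M \in unitmx ->
  \tr (invmx M) = (\det M)^-1 * \tr (\adj M).
Proof. by move=> uM; rewrite /invmx uM linearZ. Qed.

Definition row_simplex n : set 'rV[R]_n :=
  [set v | \sum_i v 0 i = 1 /\ forall i, 0 <= v 0 i].

Lemma continuous_sum_coord n : continuous (fun v : 'rV[R]_n => \sum_i v 0 i).
Proof.
apply: continuous_big => [|i _]; first exact: add_continuous.
exact: coord_continuous.
Qed.

Lemma closed_row_simplex n : closed (row_simplex (n := n)).
Proof.
have -> : row_simplex (n := n) = (fun v : 'rV[R]_n => \sum_i v 0 i) @^-1` [set x | x = 1]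
   `&` \bigcap_i ((fun v : 'rV[R]_n => v 0 i) @^-1` [set x | 0 <= x]).
  by apply/seteqP; split => v [v1 v0]; split => // i; [move=> _|]; exact: v0.
apply: closedI.
  by apply: (continuous_closedP _).1; [exact: continuous_sum_coord|exact: closed_eq].
apply: closed_bigI => i _.
by apply: (continuous_closedP _).1; [exact: coord_continuous|exact: closed_ge].
Qed.

Lemma compact_row_simplex n : compact (row_simplex (n := n)).
Proof.
apply: (subclosed_compact (@closed_row_simplex n)).
  exact: (@rV_compact R n (fun=> `[0, 1]%classic) (fun=> @segment_compact _ 0 1)).
move=> v [v1 v0] i /=; rewrite in_itv/= v0/= -v1 (bigD1 i)//= lerDl.
by rewrite sumr_ge0.
Qed.

Section LinearFamily.
Variables (n : nat) (Ws : 'I_n -> 'M[R]_n).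

Definition combination (p : 'cV[R]_n) : 'M[R]_n := \sum_i p i 0 *: Ws i.

Local Notation qf M x := ((x^T *m M *m x) 0 0).

Hypothesis n_gt0 : (0 < n)%N.
Hypothesis Ws_sym : forall i, (Ws i)^T = Ws i.
Hypothesis Ws_ge0 : forall i (x : 'cV[R]_n), 0 <= qf (Ws i) x.
Hypothesis Ws_sum : posdef (\sum_i Ws i).
Hypothesis Ws_inj : injective combination.

Let feasible : set 'cV[R]_n := [set p | posdef (combination p)] `&` @simplex R n.

Lemma combination_sym p : (combination p)^T = combination p.
Proof.
by rewrite /combination linear_sum/=; apply: eq_bigr => i _; rewrite linearZ/= Ws_sym.
Qed.

Lemma combination_ge0 (p : 'cV[R]_n) : (forall i, 0 <= p i 0) ->
  forall x : 'cV[R]_n, 0 <= qf (combination p) x.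
Proof.
move=> p0 x; rewrite qf_sum sumr_ge0// => i _.
by rewrite qf_scale mulr_ge0.
Qed.

Lemma combination_mid p q : combination (2^-1 *: (p + q)) =
  2^-1 *: (combination p + combination q).
Proof.
rewrite /combination -big_split scaler_sumr/=; apply: eq_bigr => i _.
by rewrite !mxE -scalerDl scalerA.
Qed.

Lemma feasible_mid p q : feasible p -> feasible q -> feasible (2^-1 *: (p + q)).
Proof.
move=> [/= pp [p1 p0]] [/= pq [q1 q0]]; split => /=.
  rewrite combination_mid; apply: posdef_scale; first by rewrite invr_gt0.
  exact: posdef_add.
split.
  under eq_bigr do rewrite !mxE; rewrite -mulr_sumr big_split/= p1 q1; lra.
by move=> i; rewrite !mxE mulr_ge0 ?addr_ge0// invr_ge0.
Qed.

Lemma feasible_uniform : feasible (const_mx n%:R^-1).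
Proof.
have n0 : (0 : R) < n%:R by rewrite ltr0n.
split => /=.
  rewrite /combination; under eq_bigr do rewrite mxE.
  by rewrite -scaler_sumr; apply: posdef_scale; rewrite ?invr_gt0.
split=> [|i]; last by rewrite mxE invr_ge0 ltW.
under eq_bigr do rewrite mxE.
by rewrite sumr_const card_ord -[LHS]mulr_natl mulfV// gt_eqF.
Qed.

Lemma unique_minimizer_mid_convex (h : 'M[R]_n -> R) :
  (exists2 p, feasible p & forall q, feasible q -> h (combination p) <= h (combination q)) ->
  (forall M N, posdef M -> posdef N -> M != N -> 2 * h (2^-1 *: (M + N)) < h M + h N) ->
  unique_minimizer (h \o combination) feasible.
Proof.
move=> [p fp hp] hc; exists p; split => // q [fq hq].
apply: contrapT => /eqP pq.
have := hc (combination p) (combination q) fp.1 fq.1.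
rewrite (inj_eq Ws_inj) => /(_ pq).
have := hp _ (feasible_mid fp fq); rewrite combination_mid.
have := hq _ fp; have := hp _ fq => /=; lra.
Qed.

Lemma continuous_combination i j :
  continuous (fun v : 'rV[R]_n => combination v^T i j).
Proof.
have -> : (fun v : 'rV[R]_n => combination v^T i j) =
    fun v => \sum_k v 0 k * Ws k i j.
  by apply/funext => v; rewrite summxE; apply: eq_bigr => k _; rewrite !mxE.
apply: continuous_big => [|k _ v]; first exact: add_continuous.
have ck : continuous (fun v : 'rV[R]_n => v 0 k) by exact: coord_continuous.
exact: (cvgM (ck v) (cvg_cst _)).
Qed.

Lemma row_simplexE (p : 'cV[R]_n) : simplex p -> row_simplex p^T.
Proof.
by move=> [p1 p0]; split=> [|i]; [under eq_bigr do rewrite mxE|rewrite mxE].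
Qed.

Lemma simplexE (v : 'rV[R]_n) : row_simplex v -> simplex v^T.
Proof.
by move=> [p1 p0]; split=> [|i]; [under eq_bigr do rewrite mxE|rewrite mxE].
Qed.

Lemma unique_minimizer_ln_det :
  unique_minimizer (fun p => - ln (\det (combination p))) feasible.
Proof.
apply: (@unique_minimizer_mid_convex (fun M => - ln (\det M))); last first.
  move=> M N pM pN MN; have := ln_det_mid_concave pM pN MN; lra.
have [|||v /set_mem vS vmax] := @compact_EVT_max _ R
    (fun v : 'rV[R]_n => \det (combination v^T)) (row_simplex (n := n)).
- by exists (const_mx n%:R^-1)^T; apply: row_simplexE; exact: feasible_uniform.2.
- exact: compact_row_simplex.
- by apply: continuous_subspaceT; apply: continuous_det => i j; exact: continuous_combination.
have dmax q : feasible q -> \det (combination q) <= \det (combination v^T).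
  move=> fq; rewrite -[in leLHS](trmxK q); apply: vmax.
  by apply/mem_set/row_simplexE; exact: fq.2.
have pv : posdef (combination v^T).
  apply: semidef_unit_posdef; [exact: combination_sym| |].
    by apply: combination_ge0; exact: (simplexE vS).2.
  rewrite unitmxE unitfE gt_eqF//; apply: lt_le_trans (dmax _ feasible_uniform).
  by apply: posdef_det_gt0; exact: feasible_uniform.1.
exists v^T; first by split => //; exact: simplexE.
move=> q fq; rewrite lerN2 ler_ln ?posrE ?dmax//; apply: posdef_det_gt0 => //.
exact: fq.1.
Qed.

Lemma unique_minimizer_trace_inv :
  unique_minimizer (fun p => \tr (invmx (combination p))) feasible.
Proof.
apply: (@unique_minimizer_mid_convex (fun M => \tr (invmx M))); last first.
  by move=> M N; exact: invtr_mid_convex.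
set p0 : 'cV[R]_n := const_mx n%:R^-1; set c := \tr (invmx (combination p0)).
set K := row_simplex (n := n) `&` \bigcap_(X in [set: 'M[R]_n])
  [set v | invtr_minorant X (combination v^T) <= c].
have KS v : K v -> simplex v^T by move=> [/simplexE].
have Kpd v : K v -> posdef (combination v^T).
  move=> Kv; apply: (@invtr_bounded_posdef _ _ _ c); first exact: combination_sym.
    by apply: combination_ge0; exact: (KS _ Kv).2.
  by move=> X; exact: Kv.2.
have feasK q : feasible q -> \tr (invmx (combination q)) <= c -> K q^T.
  move=> fq qc; split; first by apply: row_simplexE; exact: fq.2.
  by move=> X _ /=; rewrite trmxK; apply: le_trans qc; apply: invtr_minorant_le; exact: fq.1.
have cK : closed K.
  apply: closedI; first exact: closed_row_simplex.
  apply: closed_bigI => X _.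
  suff cX : continuous (fun v : 'rV[R]_n => invtr_minorant X (combination v^T)).
    exact: (continuous_closedP _).1 cX _ (@closed_le _ c).
  have -> : (fun v : 'rV[R]_n => invtr_minorant X (combination v^T)) =
      fun v => 2 * \tr X - \sum_i \sum_j (\sum_k X k i * combination v^T k j) * X j i.
    apply/funext => v; congr (_ - _); apply: eq_bigr => i _; rewrite mxE.
    apply: eq_bigr => j _; rewrite mxE; congr (_ * _).
    by apply: eq_bigr => k _; rewrite mxE.
  suff cS : continuous (fun v : 'rV[R]_n =>
      \sum_i \sum_j (\sum_k X k i * combination v^T k j) * X j i).
    by move=> v; exact: (cvgB (cvg_cst _) (cS v)).
  apply: continuous_big => [|i _]; first exact: add_continuous.
  apply: continuous_big => [|j _]; first exact: add_continuous.
  suff cJ : continuous (fun v : 'rV[R]_n => \sum_k X k i * combination v^T k j).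
    by move=> v; exact: (cvgM (cJ v) (cvg_cst _)).
  apply: continuous_big => [|k _ v]; first exact: add_continuous.
  exact: (cvgM (cvg_cst _) (@continuous_combination k j v)).
pose g (v : 'rV[R]_n) := (\det (combination v^T))^-1 * \tr (\adj (combination v^T)).
have gE v : K v -> \tr (invmx (combination v^T)) = g v.
  by move=> /Kpd/posdef_unit; exact: trace_invE.
have [|||v /set_mem vK vmin] := @compact_EVT_min _ R g K.
- by exists p0^T; apply: feasK => //; exact: feasible_uniform.
- by apply: (subclosed_compact cK (@compact_row_simplex n)) => v [].
- apply: continuous_in_subspaceT => v /set_mem /Kpd/posdef_unit uv.
  have dv : \det (combination v^T) != 0 by rewrite -unitfE -unitmxE.
  have cd : continuous (fun u : 'rV[R]_n => \det (combination u^T)).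
    by apply: continuous_det => i j; exact: continuous_combination.
  have ca : continuous (fun u : 'rV[R]_n => \tr (\adj (combination u^T))).
    by apply: continuous_trace_adj => i j; exact: continuous_combination.
  exact: (cvgM (cvgV dv (cd v)) (ca v)).
have {}vmin q : feasible q -> \tr (invmx (combination q)) <= c ->
    \tr (invmx (combination v^T)) <= \tr (invmx (combination q)).
  move=> fq qc; have Kq := feasK _ fq qc.
  by rewrite -[in leRHS](trmxK q) !gE//; apply: vmin; exact: mem_set.
exists v^T => [|q fq]; first by split; [exact: Kpd|exact: KS].
have [qc|/ltW cq] := leP (\tr (invmx (combination q))) c; first exact: vmin.
by apply: le_trans cq; apply: vmin => //; exact: feasible_uniform.
Qed.

End LinearFamily.
End Optimization.

Section ExponentialType.
Variable R : realType.

(* The bound makes such a function vanish identically as soon as all its derivatives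
   vanish at one point; the domain starts at -1 so that 0 is an interior point. *)
Definition exp_type (f : R -> R) := exists F : nat -> R -> R,
  [/\ F 0%N = f,
      (forall k (x : R), -1 < x -> is_derive x (1 : R) (F k) (F k.+1 x)) &
      (forall B, exists C M, [/\ 0 <= C, 1 <= M &
         forall k (x : R), -1 < x < B -> `|F k x| <= C * M ^+ k])].

Lemma is_derive1_continuous (f : R -> R) x df :
  is_derive x (1 : R) f df -> {for x, continuous f}.
Proof. by move=> fx; apply/differentiable_continuous/derivable1_diffP. Qed.

Lemma is_derive1_cvg (f : R -> R) x df : is_derive x (1 : R) f df ->
  h^-1 * (f (h + x) - f x) @[h --> 0^'] --> df.
Proof.
move=> [/cvg_ex[l fl] <-]; rewrite /derive (cvg_lim _ fl)//.
by move: fl; rewrite /GRing.scale/=; under eq_fun do rewrite mulr1.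
Qed.

Lemma derive_bound_lipschitz (f df : R -> R) (a b K x y : R) :
  (forall z, a < z < b -> is_derive z (1 : R) f (df z)) ->
  a < x < b -> a < y < b ->
  (forall z, Num.min x y <= z <= Num.max x y -> `|df z| <= K) ->
  `|f x - f y| <= K * `|x - y|.
Proof.
wlog xy : x y / y <= x => [hw|].
  have [xy|/ltW xy] := leP y x; first by have := hw x y xy; rewrite (min_r xy) (max_l xy).
  move=> fd xab yab dK; rewrite distrC [`|x - y|]distrC; apply: hw => //.
  by move=> z; rewrite (min_r xy) (max_l xy); exact: dK.
move=> fd /andP[ax xb] /andP[ay yb]; rewrite (min_r xy) (max_l xy) => dK.
have [z||c] := @MVT_segment R f df y x xy; last 1 first.
- rewrite in_itv/= => cyx ->; rewrite normrM ler_wpM2r//; exact: dK.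
- by rewrite in_itv/= => /andP[yz zx]; apply: fd; rewrite (lt_trans ay yz) (lt_trans zx xb).
- apply: derivable_within_continuous => z; rewrite in_itv/= => /andP[yz zx].
  by have [] := fd z; rewrite ?(lt_le_trans ay yz) ?(le_lt_trans zx xb).
Qed.

Lemma exp_type_cst (c : R) : exp_type (fun=> c).
Proof.
exists (fun k => if k is 0%N then fun=> c else fun=> 0); split => //.
  by move=> [|k] x _; exact: is_derive_cst.
move=> B; exists `|c|, 1; split => // k x _; rewrite expr1n mulr1.
by case: k => //; rewrite normr0.
Qed.

Lemma exp_typeD (f g : R -> R) : exp_type f -> exp_type g ->
  exp_type (fun x => f x + g x).
Proof.
move=> [F [<- dF bF]] [G [<- dG bG]]; exists (fun k => F k + G k); split => //.
  by move=> k x x1; apply: is_deriveD; [exact: dF|exact: dG].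
move=> B; have [C [M [C0 M1 FB]]] := bF B; have [D [N [D0 N1 GB]]] := bG B.
exists (C + D), (M + N); split; [exact: addr_ge0|lra|] => k x xB.
rewrite mulrDl (le_trans (ler_normD _ _))// lerD//.
  by rewrite (le_trans (FB _ _ xB))// ler_wpM2l// lerXn2r ?nnegrE; lra.
by rewrite (le_trans (GB _ _ xB))// ler_wpM2l// lerXn2r ?nnegrE; lra.
Qed.

(* The k-th derivative of [F i * G j], in a form that avoids binomial coefficients. *)
Fixpoint leibniz (F G : nat -> R -> R) k i j : R -> R :=
  if k is k'.+1 then leibniz F G k' i.+1 j + leibniz F G k' i j.+1 else F i * G j.

Lemma is_derive_leibniz (F G : nat -> R -> R) x :
  (forall k, is_derive x (1 : R) (F k) (F k.+1 x)) ->
  (forall k, is_derive x (1 : R) (G k) (G k.+1 x)) ->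
  forall k i j, is_derive x (1 : R) (leibniz F G k i j) (leibniz F G k.+1 i j x).
Proof.
move=> dF dG; elim=> [|k IH] i j /=; last by apply: is_deriveD; exact: IH.
apply: is_derive_eq; rewrite /GRing.scale/= fctE [RHS]addrC; congr (_ + _).
exact: mulrC.
Qed.

Lemma leibniz_bound (F G : nat -> R -> R) x C M D N :
  0 <= C -> 0 <= M -> 0 <= D -> 0 <= N ->
  (forall k, `|F k x| <= C * M ^+ k) -> (forall k, `|G k x| <= D * N ^+ k) ->
  forall k i j, `|leibniz F G k i j x| <= C * M ^+ i * (D * N ^+ j) * (M + N) ^+ k.
Proof.
move=> C0 M0 D0 N0 FB GB; elim=> [|k IH] i j /=.
  by rewrite mulr1 fctE normrM ler_pM.
rewrite fctE (le_trans (ler_normD _ _))// (le_trans (lerD (IH _ _) (IH _ _)))//.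
by rewrite !exprS le_eqVlt; apply/orP; left; apply/eqP; ring.
Qed.

Lemma exp_typeM (f g : R -> R) : exp_type f -> exp_type g ->
  exp_type (fun x => f x * g x).
Proof.
move=> [F [<- dF bF]] [G [<- dG bG]]; exists (fun k => leibniz F G k 0%N 0%N).
split => // [k x x1|B].
  by apply: is_derive_leibniz => m; [exact: dF|exact: dG].
have [C [M [C0 M1 FB]]] := bF B; have [D [N [D0 N1 GB]]] := bG B.
exists (C * D), (M + N); split; [exact: mulr_ge0|lra|] => k x xB.
have M0 : 0 <= M by lra.
have N0 : 0 <= N by lra.
have := leibniz_bound C0 M0 D0 N0 (fun i => FB i x xB) (fun i => GB i x xB) k 0 0.
by rewrite !expr0 !mulr1.
Qed.

Lemma exp_type_sum I (r : seq I) (P : pred I) (f : I -> R -> R) :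
  (forall i, exp_type (f i)) -> exp_type (fun x => \sum_(i <- r | P i) f i x).
Proof.
move=> ft; elim: r => [|i r IH].
  by under eq_fun do rewrite big_nil; exact: exp_type_cst.
under eq_fun do rewrite big_cons; case: (P i) => //; exact: exp_typeD.
Qed.

Lemma exp_type_prod I (r : seq I) (P : pred I) (f : I -> R -> R) :
  (forall i, exp_type (f i)) -> exp_type (fun x => \prod_(i <- r | P i) f i x).
Proof.
move=> ft; elim: r => [|i r IH].
  by under eq_fun do rewrite big_nil; exact: exp_type_cst.
under eq_fun do rewrite big_cons; case: (P i) => //; exact: exp_typeM.
Qed.

Lemma exp_type_det n (f : R -> 'M[R]_n) :
  (forall i j, exp_type (fun x => f x i j)) -> exp_type (fun x => \det (f x)).
Proof.
move=> ft; apply: exp_type_sum => s; apply: exp_typeM; first exact: exp_type_cst.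
by apply: exp_type_prod => i; exact: ft.
Qed.

Lemma exp_type_primitive (f p : R -> R) : exp_type f ->
  (forall x : R, -1 < x -> is_derive x (1 : R) p (f x)) -> exp_type p.
Proof.
move=> [F [<- dF bF]] dp; exists (fun k => if k is k'.+1 then F k' else p).
split => // [[|k] x x1|B]; [exact: dp|exact: dF|].
have [C [M [C0 M1 FB]]] := bF (Num.max B 1).
have CB : 0 <= C * (`|B| + 1) by rewrite mulr_ge0// addr_ge0.
exists (`|p 0| + C * (`|B| + 1) + C), M; split => //.
  by rewrite !addr_ge0.
have Mk k : 0 <= M ^+ k by rewrite exprn_ge0//; lra.
move=> [|k] x /andP[x1 xB].
  rewrite mulr1; have : `|p x - p 0| <= C * `|x - 0|.
    apply: (@derive_bound_lipschitz _ (F 0%N) (-1) (Num.max B 1)).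
    - by move=> z /andP[z1 _]; exact: dp.
    - by rewrite x1 lt_max xB.
    - by rewrite lt_max ltr01 orbT andbT; lra.
    move=> z /andP[]; rewrite ge_min le_max => zl zr.
    have := FB 0%N z; rewrite mulr1; apply; rewrite lt_max.
    apply/andP; split; first by case/orP: zl; lra.
    by case/orP: zr => zz; apply/orP; [left|right]; lra.
  rewrite subr0; have : `|p x| <= `|p x - p 0| + `|p 0|.
    by rewrite -[X in `|X| <= _](subrK (p 0)) ler_normD.
  have xb : `|x| <= `|B| + 1.
    by rewrite ler_norml; have := ler_norm B; have := normr_ge0 B; lra.
  have := ler_wpM2l C0 xb; lra.
apply: (le_trans (FB k x _)); first by rewrite x1 lt_max xB.
have : C * M ^+ k <= C * M ^+ k.+1.
  by rewrite ler_wpM2l// ler_weXn2l.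
have : 0 <= (`|p 0| + C * (`|B| + 1)) * M ^+ k.+1 by rewrite mulr_ge0 ?addr_ge0.
rewrite [in _ -> _ -> _]mulrDl; lra.
Qed.

Lemma le0_geometric (y K : R) : (forall j : nat, y <= K / 2 ^+ j) -> y <= 0.
Proof.
move=> yK; have h : geometric K 2^-1 @ \oo --> (0 : R).
  by apply: cvg_geometric; rewrite gtr0_norm; lra.
rewrite -(cvg_lim _ h)//; apply: limr_ge; first by apply/cvg_ex; exists 0.
by apply: nearW => j /=; rewrite exprVn.
Qed.

Section ZeroPropagation.
Variables (F : nat -> R -> R) (B C M : R).
Hypotheses (C0 : 0 <= C) (M1 : 1 <= M).
Hypothesis dF : forall k (x : R), -1 < x -> is_derive x (1 : R) (F k) (F k.+1 x).
Hypothesis FB : forall k (x : R), -1 < x < B -> `|F k x| <= C * M ^+ k.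

Lemma flat_zero_step x0 x : -1 < x0 < B -> -1 < x < B ->
  `|x - x0| <= (2 * M)^-1 -> (forall k, F k x0 = 0) -> forall k, F k x = 0.
Proof.
move=> x0B xB xx0 F0 k.
have M0 : 0 < M := lt_le_trans ltr01 M1.
suff : `|F k x| <= 0 by rewrite normr_le0 => /eqP.
apply: (@le0_geometric _ (C * M ^+ k)) => j.
elim: j k x xB xx0 => [|j IH] k x xB xx0; first by rewrite divr1 FB.
have -> : C * M ^+ k / 2 ^+ j.+1 = (C * M ^+ k.+1 / 2 ^+ j) * (2 * M)^-1.
  by rewrite !exprS; field; rewrite gt_eqF//= expf_neq0.
have h : `|F k x - F k x0| <= C * M ^+ k.+1 / 2 ^+ j * `|x - x0|.
  apply: (@derive_bound_lipschitz _ (F k.+1) (-1) B) => //.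
    by move=> z /andP[z1 _]; exact: dF.
  move=> z; rewrite ge_min le_max => /andP[zl zr]; apply: IH.
    case/andP: xB => ? ?; case/andP: x0B => ? ?.
    by apply/andP; split; [case/orP: zl|case/orP: zr]; lra.
  apply: le_trans xx0; have [h|h] := leP x0 x.
    by rewrite !ger0_norm; case/orP: zl; case/orP: zr; lra.
  by rewrite !ler0_norm; case/orP: zl; case/orP: zr; lra.
rewrite F0 subr0 in h; apply: (le_trans h); rewrite ler_wpM2l//.
by rewrite divr_ge0 ?mulr_ge0 ?exprn_ge0// ltW.
Qed.

Lemma flat_zero_everywhere x0 : -1 < x0 < B -> (forall k, F k x0 = 0) ->
  forall x, -1 < x < B -> forall k, F k x = 0.
Proof.
move=> x0B F0 x xB.
suff h (N : nat) : forall y, -1 < y < B -> `|y - x0| <= N%:R * (2 * M)^-1 ->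
    forall k, F k y = 0.
  apply: (h (Num.truncn (`|x - x0| * (2 * M))).+1 x xB).
  have M0 : 0 < M := lt_le_trans ltr01 M1.
  by rewrite ler_pdivlMr ?mulr_gt0//; exact/ltW/truncnS_gt.
elim: N => [|N IH] y yB yN.
  have -> // : y = x0.
  by apply/eqP; rewrite -subr_eq0 -normr_le0; move: yN; rewrite mul0r.
have N0 : (0 : R) <= N%:R by exact: ler0n.
have N1 : (N%:R + 1 : R) != 0 by lra.
set y' := x0 + (y - x0) * (N%:R / (N%:R + 1)).
have q0 : 0 <= N%:R / (N%:R + 1) :> R by rewrite divr_ge0//; lra.
have q1 : N%:R / (N%:R + 1) < 1 :> R by rewrite ltr_pdivrMr; lra.
have y'B : -1 < y' < B.
  move: q0 q1; rewrite /y'; set q := _ / _ => q0 q1.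
  case/andP: yB => ya yb; case/andP: x0B => xa xb.
  have h1 : 0 < (1 - q) * (x0 + 1) by rewrite mulr_gt0; lra.
  have h2 : 0 <= q * (y + 1) by rewrite mulr_ge0; lra.
  have h3 : 0 < (1 - q) * (B - x0) by rewrite mulr_gt0; lra.
  have h4 : 0 <= q * (B - y) by rewrite mulr_ge0; lra.
  by apply/andP; split; lra.
rewrite -natr1 in yN.
apply: (@flat_zero_step y') => //.
  have -> : y - y' = (y - x0) / (N%:R + 1) by rewrite /y'; field.
  rewrite normrM (gtr0_norm (x := _^-1)) ?invr_gt0; last by lra.
  by rewrite ler_pdivrMr; [rewrite mulrC|lra].
apply: IH => //; rewrite /y' addrC addKr normrM (ger0_norm q0).
rewrite mulrC -mulrA mulrC; rewrite -[leRHS]mulrC ler_wpM2r//.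
by rewrite mulrC ler_pdivrMr; [rewrite mulrC|lra].
Qed.

End ZeroPropagation.

Lemma simple_zeros_countable (g dg : R -> R) (D : set R) :
  (forall x, D x -> is_derive x (1 : R) g (dg x)) ->
  countable [set x | [/\ D x, g x = 0 & dg x != 0]].
Proof.
move=> gd; set S := [set x | _].
suff -> : S = isolated S by exact: countable_isolated.
apply/seteqP; split => [x Sx|]; last exact: isolatedS.
split; first exact: mem_set.
have [Dx gx dgx] := Sx.
have := is_derive1_cvg (gd x Dx); rewrite gx => /cvgr_neq0 - /(_ dgx).
rewrite near_withinE => /nbhs_ballP[e /= e0 he].
exists (ball x e); first exact: nbhsx_ballx.
apply/seteqP; split => [y [xy [_ gy _]]|_ ->]; last by split => //; exact: ballxx.
apply/eqP; rewrite -subr_eq0; apply/negPn/negP => yx.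
have := he (y - x); rewrite /ball/= sub0r normrN distrC => /(_ xy yx).
by rewrite subrK gy subr0 mulr0 eqxx.
Qed.

Lemma exp_type_zeros_countable (f : R -> R) : exp_type f ->
  (forall e, 0 < e -> exists2 x, 0 < x < e & f x != 0) ->
  countable [set x | 0 < x /\ f x = 0].
Proof.
move=> [F [<- dF bF]] nz.
apply: (@sub_countable _ _ _ (\bigcup_k [set x | [/\ -1 < x, F k x = 0 & F k.+1 x != 0]])).
  apply: subset_card_le => x [x0 Fx].
  apply: contrapT => hx.
  have {}hx k : F k x = 0.
    elim: k => // k IH; apply: contrapT => /eqP Fk; apply: hx.
    by exists k => //; split => //; lra.
  have [C [M [C0 M1 FB]]] := bF (x + 1).
  have [y /andP[y0 y1]] := nz (x + 1) ltac:(lra).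
  rewrite (flat_zero_everywhere C0 M1 dF FB _ hx) ?eqxx//.
    by apply/andP; split; lra.
  by apply/andP; split; lra.
apply: bigcup_countable => // k _.
by apply: (@simple_zeros_countable _ (F k.+1) [set x | -1 < x]) => x; exact: dF.
Qed.

End ExponentialType.

Section MatrixExponential.
Variable R : realType.

Definition exp_series (c : nat -> R) (x : R) : R :=
  limn (pseries (fun m => c m / m`!%:R) x).

Section ExpSeries.
Variables (c : nat -> R) (C a : R).
Hypothesis c_bound : forall m, `|c m| <= C * a ^+ m.

Let term_bound (x : R) m : `|c m / m`!%:R * x ^+ m| <= (C *: exp_coeff (a * `|x|)) m.
Proof.
rewrite -[(C *: _) m]/(C * ((a * `|x|) ^+ m / m`!%:R)).
rewrite !normrM normfV normr_nat normrX exprMn.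
rewrite [leRHS](_ : _ = C * a ^+ m / m`!%:R * `|x| ^+ m); last by ring.
by rewrite ler_wpM2r ?exprn_ge0// ler_wpM2r ?invr_ge0.
Qed.

Let cvg_bound (x : R) : cvgn (series (C *: exp_coeff (a * `|x|))).
Proof. by apply: is_cvg_seriesZ; exact: is_cvg_series_exp_coeff. Qed.

Let cvg_normed (x : R) : cvgn [normed series (fun m => c m / m`!%:R * x ^+ m)].
Proof.
apply: (@series_le_cvg _ _ (C *: exp_coeff (a * `|x|))) => [m|m|m|].
- exact: normr_ge0.
- exact: le_trans (normr_ge0 _) (term_bound x m).
- exact: term_bound.
- exact: cvg_bound.
Qed.

Lemma exp_series_cvg (x : R) : cvgn (pseries (fun m => c m / m`!%:R) x).
Proof. by apply: normed_cvg; exact: cvg_normed. Qed.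

Lemma exp_series_bound (x : R) : `|exp_series c x| <= C * expR (a * `|x|).
Proof.
have h := lim_series_norm (@cvg_normed x); apply: (le_trans h).
have -> : C * expR (a * `|x|) = limn (series (C *: exp_coeff (a * `|x|))).
  by rewrite lim_seriesZ//; exact: is_cvg_series_exp_coeff.
exact: (lim_series_le (@cvg_normed x) (@cvg_bound x) (@term_bound x)).
Qed.

End ExpSeries.

Lemma bounded_shift (c : nat -> R) C a k : (forall m, `|c m| <= C * a ^+ m) ->
  forall m, `|c (m + k)%N| <= C * a ^+ k * a ^+ m.
Proof. by move=> cb m; rewrite -mulrA -exprD addnC. Qed.

Lemma is_derive_exp_series (c : nat -> R) C a x :
  (forall m, `|c m| <= C * a ^+ m) ->
  is_derive x (1 : R) (exp_series c) (exp_series (fun m => c m.+1) x).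
Proof.
move=> cb; have dE (b : nat -> R) : pseries_diffs (fun m => b m / m`!%:R) =
    fun m => b m.+1 / m`!%:R.
  apply/funext => m; rewrite /pseries_diffs factS natrM invfM.
  by rewrite mulrCA mulVKf// pnatr_eq0.
have sb k : forall x, cvgn (pseries (fun m => c (m + k)%N / m`!%:R) x).
  by move=> y; exact: (@exp_series_cvg _ _ _ (bounded_shift k cb)).
have := @pseries_snd_diffs R (fun m => c m / m`!%:R) (`|x| + 1) x.
rewrite !dE; apply.
- by have := sb 0%N (`|x| + 1); under eq_fun do rewrite addn0.
- by have := sb 1%N (`|x| + 1); under eq_fun do rewrite addn1.
- by have := sb 2%N (`|x| + 1); under eq_fun do rewrite addn2.
- by rewrite [ltRHS]ger0_norm ?addr_ge0// ltrDl.
Qed.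

Lemma exp_type_exp_series (c : nat -> R) C a : 0 <= C -> 0 <= a ->
  (forall m, `|c m| <= C * a ^+ m) -> exp_type (exp_series c).
Proof.
move=> C0 a0 cb; exists (fun k => exp_series (fun m => c (m + k)%N)).
have Ck k : 0 <= C * a ^+ k by rewrite mulr_ge0// exprn_ge0.
split=> [|k x _|B].
- by congr exp_series; apply/funext => m; rewrite addn0.
- have := is_derive_exp_series x (bounded_shift k cb).
  by under [X in is_derive _ _ _ (exp_series X _)]eq_fun do rewrite addSnnS.
exists (C * expR (a * (`|B| + 1))), (a + 1); split => [||k x /andP[x1 xB]].
- by rewrite mulr_ge0// expR_ge0.
- by rewrite lerDr.
apply: (le_trans (exp_series_bound (bounded_shift k cb) x)).
rewrite mulrAC; apply: ler_pM; rewrite ?mulr_ge0 ?exprn_ge0 ?expR_ge0//.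
  rewrite ler_wpM2l// ler_expR ler_wpM2l// ler_norml.
  by have := ler_norm B; have := normr_ge0 B; lra.
by rewrite lerXn2r ?nnegrE ?addr_ge0// lerDl.
Qed.

Lemma exp_series_0 (c : nat -> R) : exp_series c 0 = c 0%N.
Proof.
apply: lim_near_cst => //; near=> m.
have m0 : (0 < m)%N by near: m; exists 1%N.
rewrite /pseries /series/= -(prednK m0) big_nat_recl//= big1 => [|i _].
  by rewrite fact0 divr1 mulr1 addr0.
by rewrite expr0n/= mulr0.
Unshelve. all: by end_near. Qed.

Section Expmx.
Variables (n : nat) (A : 'M[R]_n).

Lemma expmxE t i j : expmx A t i j = exp_series (fun m => (A ^+ m) i j) t.
Proof.
rewrite mxE; congr (lim (_ @ \oo)); apply/funext => N.
rewrite /pseries /series/= big_mkord summxE; apply: eq_bigr => k _.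
by rewrite mxE; ring.
Qed.

Let a := \sum_i \sum_j `|A i j|.

Lemma powermx_bound m i j : `|(A ^+ m) i j| <= 1 * a ^+ m.
Proof.
have a0 : 0 <= a by apply: sumr_ge0 => k _; exact: sumr_ge0.
rewrite mul1r; elim: m i j => [|m IH] i j.
  rewrite expr0 [1]/(1%:M) mxE expr0; case: (i == j); rewrite ?normr1//.
  by rewrite normr0.
have -> : A ^+ m.+1 = A *m A ^+ m by rewrite exprS.
rewrite mxE (le_trans (ler_norm_sum _ _ _))//.
apply: (@le_trans _ _ (\sum_k `|A i k| * a ^+ m)).
  by apply: ler_sum => k _; rewrite normrM ler_wpM2l.
rewrite -mulr_suml exprS ler_wpM2r ?exprn_ge0// /a [leRHS](bigD1 i)//= lerDl.
by apply: sumr_ge0 => k _; exact: sumr_ge0.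
Qed.

Let a0 : 0 <= a. Proof. by apply: sumr_ge0 => k _; exact: sumr_ge0. Qed.

Lemma expmx_exp_type i j : exp_type (fun t => expmx A t i j).
Proof.
have -> : (fun t => expmx A t i j) = exp_series (fun m => (A ^+ m) i j).
  by apply/funext => t; exact: expmxE.
by apply: exp_type_exp_series => [||m]; [|exact: a0|exact: powermx_bound].
Qed.

Lemma expmx_continuous i j : continuous (fun t => expmx A t i j).
Proof.
have -> : (fun t => expmx A t i j) = exp_series (fun m => (A ^+ m) i j).
  by apply/funext => t; exact: expmxE.
move=> t; apply: is_derive1_continuous.
exact: (is_derive_exp_series t (fun m => powermx_bound m i j)).
Qed.

Lemma expmx_0 : expmx A 0 = 1%:M.
Proof. by apply/matrixP => i j; rewrite expmxE exp_series_0 expr0. Qed.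

End Expmx.

Lemma expmx_tr n (A : 'M[R]_n) t : expmx A^T t = (expmx A t)^T.
Proof.
apply/matrixP => i j; rewrite [RHS]mxE !expmxE; congr exp_series.
apply/funext => m; have -> : A^T ^+ m = (A ^+ m)^T; last by rewrite mxE.
elim: m => [|m IH]; first by rewrite !expr0 [1]/(1%:M) trmx1.
by rewrite exprS exprSr [_ * _]/(_ *m _) [X in _ = X^T]/(_ *m _) trmx_mul IH.
Qed.

End MatrixExponential.

Section Gramian.
Variable R : realType.
Local Notation mu := (@lebesgue_measure R).

(* Integrating from -1 makes the primitive differentiable at 0 as well. *)
Definition primitive (f : R -> R) (x : R) : R :=
  Rintegral mu `[-1, x] f - Rintegral mu `[-1, 0] f.

Lemma primitive_0 f : primitive f 0 = 0.
Proof. exact: subrr. Qed.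

Lemma continuous_integrable_itv (f : R -> R) a b : continuous f ->
  mu.-integrable `[a, b] (EFin \o f).
Proof.
move=> cf; apply: continuous_compact_integrable; first exact: segment_compact.
exact: continuous_subspaceT.
Qed.

Lemma is_derive_primitive (f : R -> R) (x : R) : continuous f -> -1 < x ->
  is_derive x (1 : R) (primitive f) (f x).
Proof.
move=> cf x1.
have [d dE] := @continuous_FTC1_closed R f (-1) x (x + 1) ltac:(lra)
  (continuous_integrable_itv (-1) (x + 1) cf) x1 (cf x).
rewrite derive1E in dE; have {dE}d := DeriveDef d dE.
rewrite -[f x]subr0; apply: is_deriveB.
Qed.

Lemma Rintegral_primitive (f : R -> R) (t : R) : continuous f -> 0 <= t ->
  Rintegral mu `[0, t] f = primitive f t.
Proof.
move=> cf t0; rewrite /primitive.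
have m1 : (BLeft (-1) <= BRight 0 :> itv_bound R)%O by rewrite bnd_simp; lra.
rewrite (Rintegral_itvB (continuous_integrable_itv (-1) t cf) m1)//.
rewrite Rintegral_itv_obnd_cbnd//.
apply: integrableS (continuous_integrable_itv 0 t cf) => //.
exact: subset_itv_oc_cc.
Qed.

Lemma derive_ge0_ge0 (Q q : R -> R) (T : R) : 0 <= T -> Q 0 = 0 ->
  (forall x : R, -1 < x -> is_derive x (1 : R) Q (q x)) ->
  (forall x, 0 <= q x) -> 0 <= Q T.
Proof.
move=> T0 Q0 dQ q0.
have [x||c _] := @MVT_segment R Q q 0 T T0; last first.
- by rewrite Q0 !subr0 => ->; rewrite mulr_ge0.
- apply: derivable_within_continuous => x; rewrite in_itv/= => /andP[x0 _].
  by have [] := dQ x ltac:(lra).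
- by rewrite in_itv/= => /andP[x0 _]; apply: dQ; lra.
Qed.

Lemma derive_ge0_gt0 (Q q : R -> R) (T : R) : 0 < T -> Q 0 = 0 ->
  (forall x : R, -1 < x -> is_derive x (1 : R) Q (q x)) ->
  (forall x, 0 <= q x) -> {for 0, continuous q} -> 0 < q 0 -> 0 < Q T.
Proof.
move=> T0 Q0 dQ q0 cq q00.
have /cvgr_gt - /(_ _ q00) /nbhs_ballP[e /= e0 he] := cq.
have cQ (a b : R) : 0 <= a -> {within `[a, b], continuous Q}.
  move=> a0; apply: derivable_within_continuous => x; rewrite in_itv/= => /andP[x0 _].
  by have [] := dQ x ltac:(lra).
have dQ' (a b : R) : 0 <= a -> forall x : R, x \in `]a, b[%R -> is_derive x (1 : R) Q (q x).
  by move=> a0 x; rewrite in_itv/= => /andP[x0 _]; apply: dQ; lra.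
set d := Num.min T (e / 2).
have d0 : 0 < d by rewrite lt_min T0/=; lra.
have dT : d <= T by rewrite ge_min lexx.
have de : d < e by rewrite gt_min; apply/orP; right; lra.
have [c] := MVT d0 (dQ' 0 d (lexx _)) (cQ 0 d (lexx _)).
rewrite Q0 !subr0 in_itv/= => /andP[c0 cd] Qd.
have {}Qd : 0 < Q d.
  rewrite Qd mulr_gt0//; apply: he.
  by rewrite /ball/= sub0r normrN gtr0_norm//; lra.
have [c' _] := MVT_segment dT (dQ' d T (ltW d0)) (cQ d T (ltW d0)).
have : 0 <= q c' * (T - d) by rewrite mulr_ge0// subr_ge0.
lra.
Qed.

Section System.
Variables (n : nat) (A : 'M[R]_n).
Local Notation qf M x := ((x^T *m M *m x) 0 0).

Definition gram_density i j k (t : R) : R := expmx A t j i * expmx A t k i.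

Definition gram i (t : R) : 'M[R]_n := \matrix_(j, k) primitive (gram_density i j k) t.

Lemma gram_density_continuous i j k : continuous (gram_density i j k).
Proof. by move=> t; apply: cvgM; exact: expmx_continuous. Qed.

Lemma WiE i T : 0 <= T -> Wi A i T = gram i T.
Proof.
move=> T0; apply/matrixP => j k; rewrite !mxE -Rintegral_primitive//; last first.
  exact: gram_density_continuous.
congr Rintegral; apply/funext => t.
rewrite expmx_tr -(mul_delta_mx (0 : 'I_1)) mulmxA -colE -mulmxA -rowE.
by rewrite mxE big_ord1 [X in X * _]mxE [X in _ * X]mxE [X in _ * X]mxE.
Qed.

Lemma gram_sym i t : (gram i t)^T = gram i t.
Proof.
apply/matrixP => j k; rewrite !mxE; congr (primitive _ _).
by apply/funext => s; rewrite /gram_density mulrC.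
Qed.

Lemma qfE (M : 'M[R]_n) (x : 'cV[R]_n) :
  qf M x = \sum_j \sum_k (x j 0 * x k 0) * M j k.
Proof.
rewrite mxE exchange_big/=; apply: eq_bigr => k _; rewrite mxE mulr_suml.
by apply: eq_bigr => j _; rewrite mxE; ring.
Qed.

Lemma qf_gram_0 i (x : 'cV[R]_n) : qf (gram i 0) x = 0.
Proof.
rewrite qfE big1// => j _; rewrite big1// => k _.
by rewrite mxE primitive_0 mulr0.
Qed.

Lemma is_derive_qf_gram i (x : 'cV[R]_n) (t : R) : -1 < t ->
  is_derive t (1 : R) (fun s => qf (gram i s) x)
    ((\sum_j x j 0 * expmx A t j i) ^+ 2).
Proof.
move=> t1.
have -> : (fun s => qf (gram i s) x) = \sum_(j < n) \sum_(k < n)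
    (x j 0 * x k 0) *: primitive (gram_density i j k).
  apply/funext => s; rewrite qfE fct_sumE; apply: eq_bigr => j _.
  by rewrite fct_sumE; apply: eq_bigr => k _; rewrite mxE.
have -> : (\sum_j x j 0 * expmx A t j i) ^+ 2 =
    \sum_j \sum_k (x j 0 * x k 0) *: gram_density i j k t.
  rewrite expr2 mulr_suml; apply: eq_bigr => j _; rewrite mulr_sumr.
  by apply: eq_bigr => k _; rewrite /gram_density /GRing.scale/=; ring.
apply: is_derive_sum => j; apply: is_derive_sum => k; apply: is_deriveZ.
exact: is_derive_primitive (@gram_density_continuous i j k) t1.
Qed.

Lemma qf_gram_ge0 i T (x : 'cV[R]_n) : 0 <= T -> 0 <= qf (gram i T) x.
Proof.
move=> T0; apply: (derive_ge0_ge0 T0 (qf_gram_0 i x)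
  (fun t t1 => is_derive_qf_gram i x t1)) => t.
exact: sqr_ge0.
Qed.

Lemma gram_sum_posdef T : 0 < T -> posdef (\sum_i gram i T).
Proof.
move=> T0; split=> [|x x0].
  by rewrite linear_sum/=; apply: eq_bigr => i _; exact: gram_sym.
rewrite qf_sum.
apply: (@derive_ge0_gt0 (fun t => \sum_i qf (gram i t) x)
  (fun t => \sum_i (\sum_j x j 0 * expmx A t j i) ^+ 2)) => //.
- by rewrite big1// => i _; exact: qf_gram_0.
- move=> t t1.
  have -> : (fun t => \sum_i qf (gram i t) x) = \sum_(i < n) (fun t => qf (gram i t) x).
    by apply/funext => s; rewrite fct_sumE.
  by apply: is_derive_sum => i; exact: is_derive_qf_gram.
- by move=> t; apply: sumr_ge0 => i _; exact: sqr_ge0.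
- suff : continuous (fun t => \sum_i (\sum_j x j 0 * expmx A t j i) ^+ 2) by exact.
  apply: continuous_big => [|i _]; first exact: add_continuous.
  suff ci : continuous (fun t => \sum_j x j 0 * expmx A t j i).
    by move=> t; exact: (cvgM (ci t) (ci t)).
  apply: continuous_big => [|j _ t]; first exact: add_continuous.
  exact: (cvgM (cvg_cst _) (@expmx_continuous _ _ A j i t)).
have -> : \sum_i (\sum_j x j 0 * expmx A 0 j i) ^+ 2 = qf 1%:M x.
  rewrite mulmx1 mxE; apply: eq_bigr => i _; rewrite expmx_0 mxE -expr2.
  congr (_ ^+ 2); rewrite (bigD1 i)//= mxE eqxx mulr1 big1 ?addr0// => j ji.
  by rewrite mxE (negbTE ji) mulr0.
exact: (posdef1 R n).2.
Qed.

Definition gram_diag (t : R) : 'M[R]_n := \matrix_(i, j) gram i t j j.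

Lemma gram_diag_exp_type : exp_type (fun t => \det (gram_diag t)).
Proof.
apply: exp_type_det => i j.
have -> : (fun t => gram_diag t i j) = primitive (gram_density i j j).
  by apply/funext => t; rewrite !mxE.
apply: (@exp_type_primitive _ (gram_density i j j)).
  by apply: exp_typeM; exact: expmx_exp_type.
by move=> t t1; exact: is_derive_primitive (@gram_density_continuous i j j) t1.
Qed.

(* gram_diag t / t tends to the identity matrix as t tends to 0. *)
Lemma gram_diag_unit_near0 (e : R) : 0 < e ->
  exists2 t, 0 < t < e & \det (gram_diag t) != 0.
Proof.
move=> e0.
have : \det (h^-1 *: gram_diag h) @[h --> (0 : R)^'] --> \det (1%:M : 'M[R]_n).
  apply: cvg_det => i j.
  have := is_derive1_cvg (is_derive_primitive (x := 0)
    (@gram_density_continuous i j j) ltac:(lra)).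
  rewrite primitive_0 /gram_density expmx_0 !mxE.
  under eq_fun do rewrite addr0 subr0.
  rewrite -natrM mulnb andbb eq_sym.
  by under [X in _ -> X @ _ --> _]eq_fun do rewrite !mxE.
rewrite det1 => /cvgr_neq0 - /(_ (oner_neq0 _)).
rewrite near_withinE => /nbhs_ballP[d /= d0 hd].
set t := Num.min e d / 2.
have m0 : 0 < Num.min e d by rewrite lt_min e0 d0.
have [te td] : t < e /\ t < d.
  have : Num.min e d <= e by rewrite ge_min lexx.
  have : Num.min e d <= d by rewrite ge_min lexx orbT.
  by rewrite /t; split; lra.
have t0 : 0 < t by rewrite /t; lra.
exists t; first by rewrite t0 te.
have := hd t; rewrite /ball/= sub0r normrN gtr0_norm// gt_eqF//= => /(_ td isT).
by rewrite detZ mulf_eq0 negb_or => /andP[].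
Qed.

Lemma combination_gram_inj T : \det (gram_diag T) != 0 ->
  injective (combination (fun i => gram i T)).
Proof.
rewrite -unitfE -unitmxE => uD p q pq; apply: trmx_inj.
apply: (can_inj (mulmxK uD)); apply/matrixP => i j.
have /matrixP/(_ j j) := pq; rewrite !summxE => h.
rewrite !mxE; transitivity (\sum_k (p k 0 *: gram k T) j j).
  by apply: eq_bigr => k _; rewrite !mxE ord1.
by rewrite h; apply: eq_bigr => k _; rewrite !mxE ord1.
Qed.

End System.
End Gramian.

Theorem theorem1 (R : realType) (n : nat) (hn : (0 < n)%N) (A : 'M[R]_n) :
  {ae @lebesgue_measure R, forall T : R, 0 < T ->
     unique_minimizer (fT A T) (XT A T `&` @simplex R n) /\
     unique_minimizer (gT A T) (XT A T `&` @simplex R n)}.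
Proof.
have cZ : countable [set T : R | 0 < T /\ \det (gram_diag A T) = 0].
  by apply: exp_type_zeros_countable; [exact: gram_diag_exp_type|exact: gram_diag_unit_near0].
exists [set T : R | 0 < T /\ \det (gram_diag A T) = 0]; split.
- exact: countable_measurable.
- exact: countable_lebesgue_measure0.
move=> T; apply: contra_notP => nZ T0.
have WE : Wi A ^~ T = fun i => gram A i T.
  by apply/funext => i; rewrite WiE// ltW.
have inj : injective (combination (Wi A ^~ T)).
  by rewrite WE; apply: combination_gram_inj; apply/eqP => D0; exact: nZ.
have sym i : (Wi A i T)^T = Wi A i T by rewrite (WiE _ _ (ltW T0)) gram_sym.
have ge0 i (x : 'cV[R]_n) : 0 <= (x^T *m Wi A i T *m x) 0 0.
  by rewrite (WiE _ _ (ltW T0)); apply: qf_gram_ge0; exact: ltW.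
have pd : posdef (\sum_i Wi A i T).
  under eq_bigr do rewrite (WiE _ _ (ltW T0)).
  exact: gram_sum_posdef.
split.
- exact: (unique_minimizer_ln_det hn sym ge0 pd inj).
- exact: (unique_minimizer_trace_inv hn sym ge0 pd inj).
Qed.
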